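(* Suppose $\mathcal{Y}=\mathbb{R}^n$, and each $f_i$ is strongly convex with constant $\mu_i>0$ and differentiable with $\nabla f_i$ Lipschitz continuous on $\mathbb{R}^n$ with constant $L_i>0$, $i=1,\dots,m$. Let $\mu=\min_i\mu_i$, $L=\max_iL_i$, $L_h=(1/\mu)(2+2\cos(\pi/m))$, $\mu_h=(1/L)(2-2\cos(\pi/m))$, $h=-g$, and let $\boldsymbol{\lambda}^\star$ be a dual optimal solution, i.e. a maximizer of $g$. Let $\{\boldsymbol{\lambda}^{(k)}\}_{k\ge0}$ be generated by the inexact dual algorithm with distortions satisfying $\|\mathbf{r}_i^{(k)}\|\le\varepsilon_i$ for all $i,k$ and with constant stepsize $\gamma_k=\gamma$ for all $k\ge0$, where $0<\gamma\le1/L_h$. Then for all $k\ge0$, $$h(\boldsymbol{\lambda}^{(k)})-h(\boldsymbol{\lambda}^\star)\le(1-\gamma\mu_h)^k\left(h(\boldsymbol{\lambda}^{(0)})-h(\boldsymbol{\lambda}^\star)\right)+\frac{\epsilon^2}{2\mu_h}.$$ Moreover, $\limsup_k\left(h(\boldsymbol{\lambda}^{(k)})-h(\boldsymbol{\lambda}^\star)\right)\le\epsilon^2/(2\mu_h)$.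
   Context: Let $m\ge2$, $n\ge1$ be integers, $\mathcal{Y}\subseteq\mathbb{R}^n$ a closed convex set, and $f_i:\mathbb{R}^n\to\mathbb{R}$, $i=1,\dots,m$, strictly convex closed functions. For $\mathbf{y}=(\mathbf{y}_1,\dots,\mathbf{y}_m)\in(\mathbb{R}^n)^m=\mathbb{R}^{nm}$ put $f(\mathbf{y})=\sum_{i=1}^m f_i(\mathbf{y}_i)$, let $\bar{\mathcal{Y}}=\mathcal{Y}^m$, and $\mathbf{A}\mathbf{y}=(\mathbf{y}_1-\mathbf{y}_2,\dots,\mathbf{y}_{m-1}-\mathbf{y}_m)\in\mathbb{R}^{n(m-1)}$. The dual function is $g(\boldsymbol{\lambda})=\inf_{\mathbf{y}\in\bar{\mathcal{Y}}}\big[f(\mathbf{y})+\boldsymbol{\lambda}^{T}\mathbf{A}\mathbf{y}\big]$, $\boldsymbol{\lambda}\in\mathbb{R}^{n(m-1)}$. Inexact dual algorithm: start from any $\boldsymbol{\lambda}^{(0)}\in\mathbb{R}^{n(m-1)}$; for $k=0,1,2,\dots$ let $\mathbf{y}^{(k)}=\arg\min_{\mathbf{y}\in\bar{\mathcal{Y}}}\big[f(\mathbf{y})+(\boldsymbol{\lambda}^{(k)})^{T}\mathbf{A}\mathbf{y}\big]$, let $\hat{\mathbf{y}}_i^{(k)}=\mathbf{y}_i^{(k)}+\mathbf{r}_i^{(k)}$ where $\mathbf{r}_i^{(k)}\in\mathbb{R}^n$ are arbitrary distortions, let $\hat{\mathbf{d}}^{(k)}=\mathbf{A}\hat{\mathbf{y}}^{(k)}$,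 and set $\boldsymbol{\lambda}^{(k+1)}=\boldsymbol{\lambda}^{(k)}+\gamma_k\hat{\mathbf{d}}^{(k)}$. The distortions are bounded by constants: $\|\mathbf{r}_i^{(k)}\|\le\varepsilon_i$ for all $i$ and $k$, and $\epsilon:=\sqrt{\sum_{i=1}^{m-1}(\varepsilon_i+\varepsilon_{i+1})^2}$. Norms are Euclidean. A function $\varphi$ is strongly convex with constant $\sigma>0$ if $\varphi-\frac{\sigma}{2}\|\cdot\|^2$ is convex. *)

(* Defs.v *)
From mathcomp Require Export all_boot all_order all_algebra.
From mathcomp Require Export all_classical all_reals all_analysis.

Set Implicit Arguments.
Unset Strict Implicit.
Unset Printing Implicit Defensive.

Export Order.TTheory GRing.Theory Num.Theory.
Export numFieldNormedType.Exports.

Local Open Scope classical_set_scope.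
Local Open Scope ring_scope.

(* A point (y_1, ..., y_m) of (R^n)^m is the matrix in 'M[R]_(m, n) whose rows
   are the y_i; likewise a multiplier lambda in R^(n(m-1)) is a matrix in
   'M[R]_(m.-1, n). The inner product and norm below are those of the stacked
   vectors; on 'rV[R]_n they are the usual Euclidean ones. The library norm
   `|x| on matrices is the sup norm, so it is only used through the topology
   (closedness, differentiability), which is the same for both norms. *)

Definition dotm (R : realType) (p q : nat) (u v : 'M[R]_(p, q)) : R :=
  \sum_i \sum_j u i j * v i j.

Definition enorm (R : realType) (p q : nat) (u : 'M[R]_(p, q)) : R :=
  Num.sqrt (dotm u u).

Definition closed_function (R : realType) (n : nat) (f : 'rV[R]_n -> R) : Prop :=
  closed [set p : 'rV[R]_n * R | f p.1 <= p.2].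

Definition strictly_convex (R : realType) (n : nat) (f : 'rV[R]_n -> R) : Prop :=
  forall (x y : 'rV[R]_n) (t : R), x != y -> 0 < t -> t < 1 ->
    f (t *: x + (1 - t) *: y) < t * f x + (1 - t) * f y.

Definition strongly_convex (R : realType) (n : nat) (sigma : R)
    (f : 'rV[R]_n -> R) : Prop :=
  @convex_function R 'rV[R]_n setT
    (fun x => f x - sigma / 2 * enorm x ^+ 2).

(* The vector of partial derivatives; it represents the differential at points
   where f is differentiable. *)
Definition grad (R : realType) (n : nat) (f : 'rV[R]_n -> R) (x : 'rV[R]_n) :
    'rV[R]_n :=
  \row_(j < n) 'D_(delta_mx 0 j) f x.

Definition lipschitz_grad (R : realType) (n : nat) (L : R)
    (f : 'rV[R]_n -> R) : Prop :=
  forall x y : 'rV[R]_n, enorm (grad f x - grad f y) <= L * enorm (x - y).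

(* The default element u 0 of the iterated operators belongs to the family, so
   these are the minimum and the maximum of u. *)
Definition family_min (R : realType) (m : nat) (m_gt0 : (0 < m)%N)
    (u : 'I_m -> R) : R :=
  \big[Num.min/u (Ordinal m_gt0)]_(i < m) u i.

Definition family_max (R : realType) (m : nat) (m_gt0 : (0 < m)%N)
    (u : 'I_m -> R) : R :=
  \big[Num.max/u (Ordinal m_gt0)]_(i < m) u i.

(* The two ends i and i + 1, as indices in 'I_m, of the i-th consecutive pair. *)
Definition pair_fst (m : nat) (i : 'I_m.-1) : 'I_m :=
  widen_ord (leq_pred m) i.

Lemma pair_snd_subproof (m : nat) (i : 'I_m.-1) : (i.+1 < m)%N.
Proof. by rewrite -ltn_predRL. Qed.

Definition pair_snd (m : nat) (i : 'I_m.-1) : 'I_m :=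
  Ordinal (pair_snd_subproof i).

(* A y = (y_1 - y_2, ..., y_{m-1} - y_m) *)
Definition diff_op (R : realType) (m n : nat) (y : 'M[R]_(m, n)) :
    'M[R]_(m.-1, n) :=
  \matrix_(i, j) (y (pair_fst i) j - y (pair_snd i) j).

Definition prodset (R : realType) (m n : nat) (Y : set 'rV[R]_n) :
    set 'M[R]_(m, n) :=
  [set y | forall i, Y (row i y)].

Definition objective (R : realType) (m n : nat) (f : 'I_m -> 'rV[R]_n -> R)
    (y : 'M[R]_(m, n)) : R :=
  \sum_i f i (row i y).

Definition lagrangian (R : realType) (m n : nat) (f : 'I_m -> 'rV[R]_n -> R)
    (lambda : 'M[R]_(m.-1, n)) (y : 'M[R]_(m, n)) : R :=
  objective f y + dotm lambda (diff_op y).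

(* The infimum is taken in the extended reals, so that no convention for the
   infimum of an unbounded set of reals is involved. *)
Definition dual (R : realType) (m n : nat) (Y : set 'rV[R]_n)
    (f : 'I_m -> 'rV[R]_n -> R) (lambda : 'M[R]_(m.-1, n)) : \bar R :=
  ereal_inf [set (lagrangian f lambda y)%:E | y in prodset Y].

Definition neg_dual (R : realType) (m n : nat) (Y : set 'rV[R]_n)
    (f : 'I_m -> 'rV[R]_n -> R) (lambda : 'M[R]_(m.-1, n)) : \bar R :=
  (- dual Y f lambda)%E.

Definition dual_optimal (R : realType) (m n : nat) (Y : set 'rV[R]_n)
    (f : 'I_m -> 'rV[R]_n -> R) (lambda : 'M[R]_(m.-1, n)) : Prop :=
  forall lambda' : 'M[R]_(m.-1, n), (dual Y f lambda' <= dual Y f lambda)%E.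

Definition is_argmin (T : Type) (R : realType) (D : set T) (F : T -> R)
    (x : T) : Prop :=
  D x /\ forall x', D x' -> F x <= F x'.

(* The rows of r k are the distortions r_i^(k); lambda 0 is arbitrary. *)
Definition inexact_dual_algorithm (R : realType) (m n : nat)
    (Y : set 'rV[R]_n) (f : 'I_m -> 'rV[R]_n -> R) (gamma : nat -> R)
    (r : nat -> 'M[R]_(m, n)) (y : nat -> 'M[R]_(m, n))
    (lambda : nat -> 'M[R]_(m.-1, n)) : Prop :=
  forall k : nat,
    is_argmin (prodset Y) (lagrangian f (lambda k)) (y k) /\
    lambda k.+1 = lambda k + gamma k *: diff_op (y k + r k).

Definition total_distortion (R : realType) (m : nat) (eps : 'I_m -> R) : R :=
  Num.sqrt (\sum_(i < m.-1) (eps (pair_fst i) + eps (pair_snd i)) ^+ 2).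

(* Main.v *)
(* Let y be the minimizer of the Lagrangian at lambda and let B be the adjoint
   of A. Strong convexity of f gives the quadratic lower bound
   Lag(lambda, z) >= Lag(lambda, y) + mu/2 |z - y|^2, and Lipschitz gradients
   give the matching upper bound with L. Perturbing lambda by d adds
   <B d, z> = <d, A z> to the Lagrangian, so, minimizing these quadratics in z,
   |B d|^2 / (2 mu) and |B d|^2 / (2 L) control g(lambda + d) without
   differentiating g. As B d is the forward difference of d padded by zeros,
   |B d|^2 is the energy of a Dirichlet path, which lies between
   (2 - 2 cos(pi/m)) |d|^2 and (2 + 2 cos(pi/m)) |d|^2. The lower quadratic then
   yields the descent inequality with L_h and the upper one the
   Polyak-Lojasiewicz inequality h - h* <= |A y|^2 / (2 mu_h); with
   gamma L_h <= 1 a step contracts h - h* by 1 - gamma mu_h up to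
   gamma epsilon^2 / 2. *)

From mathcomp Require Import ring lra zify.
Require Import Defs.

Set Implicit Arguments.
Unset Strict Implicit.
Unset Printing Implicit Defensive.

Local Open Scope classical_set_scope.
Local Open Scope ring_scope.

Section EuclideanMatrix.
Variables (R : realType) (p q : nat).
Implicit Types (u v w : 'M[R]_(p, q)) (a : R).

Lemma dotmC u v : dotm u v = dotm v u.
Proof. by apply: eq_bigr => i _; apply: eq_bigr => j _; rewrite mulrC. Qed.

Lemma dotmDl u v w : dotm (u + v) w = dotm u w + dotm v w.
Proof.
rewrite /dotm -big_split; apply: eq_bigr => i _ /=.
by rewrite -big_split; apply: eq_bigr => j _ /=; rewrite mxE mulrDl.
Qed.

Lemma dotmZl a u v : dotm (a *: u) v = a * dotm u v.
Proof.
rewrite /dotm mulr_sumr; apply: eq_bigr => i _.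
by rewrite mulr_sumr; apply: eq_bigr => j _; rewrite mxE mulrA.
Qed.

Lemma dotmNl u v : dotm (- u) v = - dotm u v.
Proof. by rewrite -scaleN1r dotmZl mulN1r. Qed.

Lemma dotmDr u v w : dotm u (v + w) = dotm u v + dotm u w.
Proof. by rewrite dotmC dotmDl !(dotmC u). Qed.

Lemma dotmZr a u v : dotm u (a *: v) = a * dotm u v.
Proof. by rewrite dotmC dotmZl dotmC. Qed.

Lemma dotmNr u v : dotm u (- v) = - dotm u v.
Proof. by rewrite dotmC dotmNl dotmC. Qed.

Definition dotmE := (dotmDl, dotmDr, dotmNl, dotmNr, dotmZl, dotmZr).

Lemma dotm_ge0 u : 0 <= dotm u u.
Proof. by apply: sumr_ge0 => i _; apply: sumr_ge0 => j _; rewrite -expr2 sqr_ge0. Qed.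

Lemma dotm_eq0 u : (dotm u u == 0) = (u == 0).
Proof.
apply/eqP/eqP => [u0|->]; last by rewrite -(scale0r 0) dotmZl mul0r.
apply/matrixP => i j; rewrite mxE; apply/eqP; rewrite -sqrf_eq0 expr2.
have Hi : forall i, true -> 0 <= \sum_j u i j * u i j.
  by move=> k _; apply: sumr_ge0 => l _; rewrite -expr2 sqr_ge0.
have /(_ i isT) := psumr_eq0P Hi u0.
move/psumr_eq0P => -> //.
by move=> l _; rewrite -expr2 sqr_ge0.
Qed.

Lemma enorm_ge0 u : 0 <= enorm u.
Proof. exact: sqrtr_ge0. Qed.

Lemma sqr_enorm u : enorm u ^+ 2 = dotm u u.
Proof. by rewrite sqr_sqrtr ?dotm_ge0. Qed.

Lemma dotm_le_enorm u v : dotm u v <= enorm u * enorm v.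
Proof.
have [u0|u0] := eqVneq (enorm u) 0.
  have /eqP : dotm u u = 0 by rewrite -sqr_enorm u0 expr0n.
  by rewrite dotm_eq0 => /eqP ->; rewrite -(scale0r 0) dotmZl mul0r mulr_ge0 ?enorm_ge0.
have [v0|v0] := eqVneq (enorm v) 0.
  have /eqP : dotm v v = 0 by rewrite -sqr_enorm v0 expr0n.
  by rewrite dotm_eq0 => /eqP ->; rewrite -(scale0r 0) dotmZr mul0r mulr_ge0 ?enorm_ge0.
have uv0 : 0 < enorm u * enorm v.
  by rewrite mulr_gt0 // lt0r ?u0 ?v0 enorm_ge0.
have := dotm_ge0 (enorm v *: u - enorm u *: v).
rewrite !dotmE (dotmC v u) -!sqr_enorm.
by move=> h; rewrite -(ler_pM2l uv0); move: h; lra.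
Qed.

Lemma enormB_le u v : enorm (u - v) <= enorm u + enorm v.
Proof.
rewrite -ler_sqr ?nnegrE ?addr_ge0 ?enorm_ge0 // sqr_enorm !dotmE (dotmC v u).
have := dotm_le_enorm u (- v); rewrite dotmNr.
have -> : enorm (- v) = enorm v by rewrite /enorm dotmNl dotmNr opprK.
rewrite sqrrD -!sqr_enorm; lra.
Qed.

Lemma dotm_rows u v : dotm u v = \sum_i dotm (row i u) (row i v).
Proof.
apply: eq_bigr => i _; rewrite /dotm big_ord1.
by apply: eq_bigr => j _; rewrite !mxE.
Qed.

End EuclideanMatrix.

Section PathSpectrum.
Variable R : realType.
Implicit Type e : nat -> R.

Lemma summation_by_parts e (Y : nat -> R) (p : nat) : e 0%N = 0 ->
  \sum_(i < p) e i.+1 * (Y i - Y i.+1) =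
  \sum_(k < p.+1) (e k.+1 - e k) * Y k - e p.+1 * Y p.
Proof.
move=> e0; elim: p => [|p IH]; first by rewrite big_ord0 big_ord1 e0 /=; ring.
by rewrite big_ord_recr IH /= [in RHS]big_ord_recr /=; ring.
Qed.

Variable m : nat.
Hypothesis m_ge2 : (2 <= m)%N.
Local Notation c := (cos (pi / m%:R : R)).
Let s (k : nat) : R := sin (k%:R * (pi / m%:R)).

Let m_gt0 : 0 < m%:R :> R.
Proof. by rewrite ltr0n; apply: leq_trans m_ge2. Qed.

Let s_gt0 k : (0 < k < m)%N -> 0 < s k.
Proof.
move=> /andP[k0 km]; apply: sin_gt0_pi.
rewrite mulr_gt0 ?ltr0n ?divr_gt0 ?pi_gt0 //=.
by rewrite mulrCA gtr_pMr ?pi_gt0 // ltr_pdivrMr // mul1r ltr_nat.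
Qed.

Let sSS k : s k.+2 = 2 * c * s k.+1 - s k.
Proof.
rewrite /s; set x := pi / _.
have -> : k.+2%:R * x = k.+1%:R * x + x by rewrite -[k.+2%:R]natr1; ring.
have -> : k%:R * x = k.+1%:R * x - x by rewrite -[k.+1%:R]natr1; ring.
by rewrite sinD sinB; ring.
Qed.

Lemma cos_pi_div_ge0 : 0 <= c.
Proof.
apply: cos_ge0_pihalf.
have p0 := pi_gt0 R.
have hm : pi / m%:R <= pi / 2 :> R.
  by rewrite ler_pM2l // lef_pV2 ?posrE // ler_nat.
have : 0 < pi / m%:R :> R by rewrite divr_gt0.
move=> h; apply/andP; split => //; lra.
Qed.

Lemma cos_pi_div_lt1 : c < 1.
Proof.
have p0 := pi_gt0 R.
rewrite -[ltRHS]cos0 ltr_cos ?in_itv /= ?lexx ?ltW ?divr_gt0 //.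
by rewrite ltr_pdivrMr // ltr_pMr // ltr1n.
Qed.

(* The ground state [s k = sin (k pi / m)] of the Dirichlet path turns the
   form into a sum of squares [(s (k+1) e k - sigma s k e (k+1))^2]. *)
Let ground_state (sigma : R) e k : sigma ^+ 2 = 1 -> e 0%N = 0 ->
  (0 < k < m)%N ->
  s k.+1 * e k ^+ 2 + s k * (2 * sigma * \sum_(i < k) e i * e i.+1)
  <= s k * (2 * c * \sum_(i < k.+1) e i ^+ 2).
Proof.
move=> sigma2 e0; elim: k => // -[|k] IH /andP[_ km].
  have -> : s 2 = 2 * c * s 1 by rewrite sSS /s mul0r sin0 subr0.
  by rewrite big_ord1 2!big_ord_recr big_ord0 /= e0; lra.
have k1m : (0 < k.+1 < m)%N by rewrite /= ltnW.
move: (IH k1m) => {}IH; have v0 := s_gt0 k1m.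
rewrite sSS big_ord_recr [in leRHS]big_ord_recr /=.
move: IH; set X := \sum_(i < _) _; set Y := \sum_(i < _) _.
set a := e k.+1; set b := e k.+2; set u := s k.+2; set v := s k.+1.
have u0 : 0 < u by apply: s_gt0; rewrite km.
move=> /(ler_wpM2l (ltW u0)) IH; rewrite -(ler_pM2l v0) -/v.
have : 0 <= u ^+ 2 * a ^+ 2 - 2 * sigma * u * v * a * b + v ^+ 2 * b ^+ 2.
  have -> : v ^+ 2 * b ^+ 2 = sigma ^+ 2 * v ^+ 2 * b ^+ 2 by rewrite sigma2 mul1r.
  by rewrite (_ : _ + _ = (u * a - sigma * v * b) ^+ 2) ?sqr_ge0 //; ring.
by move: IH; lra.
Qed.

Let cross_le (sigma : R) e : sigma ^+ 2 = 1 -> e 0%N = 0 -> e m = 0 ->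
  2 * sigma * \sum_(i < m) e i * e i.+1 <= 2 * c * \sum_(i < m) e i ^+ 2.
Proof.
move=> sigma2 e0 em.
have km : (0 < m.-1 < m)%N by rewrite -subn1; lia.
have := ground_state sigma2 e0 km; rewrite prednK; last exact: ltnW.
have -> : s m = 0 by rewrite /s mulrCA divff ?mulr1 ?sinpi // gt_eqF.
rewrite mul0r add0r ler_pM2l ?s_gt0 //; apply: le_trans.
have cut p : e p.+1 = 0 ->
    \sum_(i < p.+1) e i * e i.+1 = \sum_(i < p) e i * e i.+1.
  by move=> ep; rewrite big_ord_recr /= ep mulr0 addr0.
by have := cut m.-1; rewrite prednK => [->//|]; exact: ltnW.
Qed.

Lemma path_energy_bounds e : e 0%N = 0 -> e m = 0 ->
  (2 - 2 * c) * \sum_(i < m) e i ^+ 2 <= \sum_(i < m) (e i.+1 - e i) ^+ 2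
  <= (2 + 2 * c) * \sum_(i < m) e i ^+ 2.
Proof.
move=> e0 em.
have -> : \sum_(i < m) (e i.+1 - e i) ^+ 2 =
    2 * \sum_(i < m) e i ^+ 2 - 2 * \sum_(i < m) e i * e i.+1.
  transitivity (2 * \sum_(i < m) e i ^+ 2 - 2 * \sum_(i < m) e i * e i.+1
                + e m ^+ 2 - e 0%N ^+ 2); last by rewrite e0 em; ring.
  elim: (m) => [|k IH]; first by rewrite !big_ord0; ring.
  by rewrite 3!big_ord_recr IH /=; ring.
have := cross_le (expr1n _ 2) e0 em.
have := cross_le (sqrr_sign R 1) e0 em; rewrite expr1.
by move=> h1 h2; apply/andP; split; move: h1 h2; lra.
Qed.

End PathSpectrum.

Section DifferenceAdjoint.
Variables (R : realType) (m n : nat).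
Hypothesis m_ge2 : (2 <= m)%N.
Implicit Types (d : 'M[R]_(m.-1, n)) (v : 'M[R]_(m, n)).

(* The column [j] of [d], shifted to the indices 1, ..., m - 1 and extended by
   0, so that the adjoint of [diff_op] becomes a forward difference. *)
Definition padded d (j : 'I_n) (k : nat) : R :=
  if k is k'.+1 then
    if insub k' is Some i then d i j else 0
  else 0.

Definition diff_adj d : 'M[R]_(m, n) :=
  \matrix_(k, j) (padded d j k.+1 - padded d j k).

Lemma padded_ord d j (i : 'I_m.-1) : padded d j i.+1 = d i j.
Proof. by rewrite /= valK. Qed.

Lemma padded_last d j : padded d j m = 0.
Proof. by rewrite -[X in padded _ _ X](prednK (ltnW m_ge2)) /= insubF // ltnn. Qed.

Lemma diff_adjP d v : dotm d (diff_op v) = dotm (diff_adj d) v.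
Proof.
rewrite /dotm exchange_big [RHS]exchange_big; apply: eq_bigr => j _ /=.
pose Y k := if insub k is Some i then v i j else 0.
have YE (i : 'I_m) : Y i = v i j by rewrite /Y valK.
transitivity (\sum_(i < m.-1) padded d j i.+1 * (Y i - Y i.+1)).
  apply: eq_bigr => i _; rewrite padded_ord mxE.
  by rewrite -(YE (pair_fst i)) -(YE (pair_snd i)).
rewrite summation_by_parts // prednK; last exact: ltnW.
rewrite padded_last mul0r subr0.
by apply: eq_bigr => i _; rewrite YE mxE.
Qed.

Lemma dotm_padded d :
  dotm d d = \sum_j \sum_(k < m) padded d j k ^+ 2.
Proof.
rewrite /dotm exchange_big; apply: eq_bigr => j _ /=.
have H p : \sum_(k < p.+1) padded d j k ^+ 2 = \sum_(k < p) padded d j k.+1 ^+ 2.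
  by rewrite big_ord_recl /= expr0n add0r.
have := H m.-1; rewrite prednK => [->|]; last exact: ltnW.
by apply: eq_bigr => i _; rewrite padded_ord expr2.
Qed.

Lemma diff_adj_bounds d :
  (2 - 2 * cos (pi / m%:R)) * dotm d d <= dotm (diff_adj d) (diff_adj d)
  <= (2 + 2 * cos (pi / m%:R)) * dotm d d.
Proof.
have -> : dotm (diff_adj d) (diff_adj d) =
    \sum_j \sum_(k < m) (padded d j k.+1 - padded d j k) ^+ 2.
  rewrite /dotm exchange_big; apply: eq_bigr => j _ /=.
  by apply: eq_bigr => i _; rewrite !mxE expr2.
have B j := path_energy_bounds m_ge2 (erefl : padded d j 0%N = 0) (padded_last d j).
rewrite dotm_padded !mulr_sumr.
by apply/andP; split; apply: ler_sum => j _; case/andP: (B j).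
Qed.

End DifferenceAdjoint.

Lemma limn_esup_le_geometric (R : realType) (u : nat -> \bar R) (q C D : R) :
  `|q| < 1 -> (forall k, (u k <= (q ^+ k * C + D)%:E)%E) ->
  (limn_esup u <= D%:E)%E.
Proof.
move=> q1 uk.
pose v k := (q ^+ k * C + D)%:E.
have vD : v @ \oo --> D%:E.
  apply: cvg_EFin; first exact: nearW.
  rewrite -[X in _ --> X]add0r; apply: cvgD; last exact: cvg_cst.
  by rewrite -[X in _ --> X](mul0r C); apply: cvgM; [exact: cvg_expr|exact: cvg_cst].
rewrite -(cvg_limn_einf_sup vD).2 !limn_esup_lim.
apply: lee_lim; [exact: is_cvg_esups..|apply: nearW => k].
apply: ge_ereal_sup => _ [j /= kj <-].
by apply: le_trans (uk j) _; apply: ereal_sup_ubound; exists j.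
Qed.

Lemma le0_of_le_small_mul (R : realType) (a K : R) :
  (forall t, 0 < t -> t < 1 -> a <= t * K) -> a <= 0.
Proof.
move=> aK; rewrite leNgt; apply/negP => a0.
have aK2 : a <= 2^-1 * K by apply: aK; lra.
have K0 : 0 < K by lra.
suff : a <= a / (2 * K) * K by rewrite invfM mulrA mulfVK ?gt_eqF //; lra.
apply: aK; first by rewrite divr_gt0 // mulr_gt0.
by rewrite ltr_pdivrMr ?mulr_gt0 //; lra.
Qed.

Lemma le_quadratic_of_deriv (R : realType) (phi dphi : R -> R) (K : R) :
  (forall t : R, is_derive t 1 phi (dphi t)) ->
  (forall t, 0 < t -> t < 1 -> dphi t - dphi 0 <= K * t) ->
  phi 1 <= phi 0 + dphi 0 + K / 2.
Proof.
move=> Dphi dphi_le.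
pose psi : R -> R := phi - (dphi 0 \*: id) - ((K / 2) \*: (id ^+ 2)).
have Dpsi : forall x : R, is_derive x 1 psi (dphi x - dphi 0 - K * x).
  move=> x; apply: is_derive_eq; rewrite /GRing.scale /= expr1; by field.
have psiE t : psi t = phi t - dphi 0 * t - K / 2 * t ^+ 2 by [].
suff : psi 1 <= psi 0 by rewrite !psiE; lra.
apply: (@ler0_derive1_le_cc R psi 0 1) => //.
- move=> x; rewrite in_itv /= => /andP[x0 x1].
  by rewrite derive1E derive_val; have := dphi_le x x0 x1; lra.
- by apply: derivable_within_continuous => x _.
- by rewrite in_itv /= lexx ler01.
- by rewrite in_itv /= lexx ler01.
Qed.

Section OneFunction.
Variables (R : realType) (n : nat) (f : 'rV[R]_n -> R).

Lemma derive_grad (x v : 'rV[R]_n) :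
  differentiable f x -> 'D_v f x = dotm (grad f x) v.
Proof.
move=> df; rewrite deriveE // [v in 'd f x v]row_sum_delta linear_sum /dotm big_ord1.
by apply: eq_bigr => j _; rewrite linearZ /= mxE deriveE // mulrC.
Qed.

Lemma is_derive_line (x v : 'rV[R]_n) (t : R) : differentiable f (x + t *: v) ->
  is_derive t (1 : R) (fun s : R => f (x + s *: v)) (dotm (grad f (x + t *: v)) v).
Proof.
move=> df.
have E : (fun h : R => h^-1 *: (((fun s : R => f (x + s *: v)) \o shift t)
                                 (h *: (1 : R)) - f (x + t *: v)))
       = (fun h : R => h^-1 *: ((f \o shift (x + t *: v)) (h *: v) - f (x + t *: v))).
  apply/funext => h /=; congr (_ *: (f _ - _)).
  by rewrite [h *: 1]mulr1 scalerDl addrCA.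
split.
  by rewrite /derivable E; exact: diff_derivable.
by rewrite /derive E -derive_grad.
Qed.

Lemma lipschitz_grad_upper (L : R) :
  0 <= L -> (forall x, differentiable f x) -> lipschitz_grad L f ->
  forall x v, f (x + v) <= f x + dotm (grad f x) v + L / 2 * dotm v v.
Proof.
move=> L0 df fL x v.
have := @le_quadratic_of_deriv R _ _ (L * dotm v v) (fun t => is_derive_line (df (x + t *: v))).
rewrite scale1r scale0r addr0 (mulrAC L); apply => t t0 _.
rewrite -dotmNl -dotmDl.
apply: le_trans (dotm_le_enorm _ _) _.
apply: le_trans (ler_wpM2r (enorm_ge0 _) (fL _ _)) _.
have -> : x + t *: v - x = t *: v by rewrite addrC addKr.
have -> : enorm (t *: v) = t * enorm v.
  by rewrite /enorm dotmZl dotmZr mulrA -expr2 sqrtrM ?sqr_ge0 // sqrtr_sqr gtr0_norm.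
by rewrite -sqr_enorm expr2 le_eqVlt; apply/orP; left; apply/eqP; ring.
Qed.

Lemma strongly_convex_le (sigma : R) : strongly_convex sigma f ->
  forall (x y : 'rV[R]_n) (t : R), 0 <= t -> t <= 1 ->
  f (t *: x + (1 - t) *: y) <= t * f x + (1 - t) * f y
    - sigma / 2 * (t * (1 - t)) * dotm (x - y) (x - y).
Proof.
move=> fsc x y t t0 t1.
have := fsc (Itv01 t0 t1) x y (in_setT _) (in_setT _).
rewrite convRE /conv /= /unstable.onem !sqr_enorm !dotmE (dotmC y x).
lra.
Qed.

End OneFunction.

Section Lagrangian.
Variables (R : realType) (m n : nat) (f : 'I_m -> 'rV[R]_n -> R).
Hypothesis m_ge2 : (2 <= m)%N.
Variables (mui Li : 'I_m -> R) (mu L : R).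
Hypothesis mu_gt0 : 0 < mu.
Hypothesis mu_le : forall i, mu <= mui i.
Hypothesis f_strong : forall i, strongly_convex (mui i) (f i).
Hypothesis L_gt0 : 0 < L.
Hypothesis Li_gt0 : forall i, 0 < Li i.
Hypothesis Li_le : forall i, Li i <= L.
Hypothesis f_diff : forall i x, differentiable (f i) x.
Hypothesis f_lip : forall i, lipschitz_grad (Li i) (f i).

Local Notation argmin lam y := (is_argmin (prodset setT) (lagrangian f lam) y).
Local Notation c := (cos (pi / m%:R : R)).

Lemma lagrangian_adj lam y :
  lagrangian f lam y = objective f y + dotm (diff_adj lam) y.
Proof. by rewrite /lagrangian diff_adjP. Qed.

Lemma lagrangian_shift lam lam' y :
  lagrangian f lam' y = lagrangian f lam y + dotm (diff_adj (lam' - lam)) y.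
Proof. by rewrite /lagrangian -diff_adjP // dotmDl dotmNl; ring. Qed.

Lemma objective_strongly_convex (y z : 'M[R]_(m, n)) (t : R) : 0 <= t -> t <= 1 ->
  objective f (t *: z + (1 - t) *: y) <= t * objective f z + (1 - t) * objective f y
    - mu / 2 * (t * (1 - t)) * dotm (z - y) (z - y).
Proof.
move=> t0 t1; rewrite dotm_rows /objective !mulr_sumr -big_split -sumrB /=.
apply: ler_sum => i _.
have := strongly_convex_le (f_strong i) (row i z) (row i y) t0 t1.
have -> : row i (t *: z + (1 - t) *: y) = t *: row i z + (1 - t) *: row i y.
  by rewrite linearD !linearZ.
have -> : row i (z - y) = row i z - row i y by rewrite linearB.
move=> /le_trans; apply.
rewrite lerD2l lerN2 ler_wpM2r ?dotm_ge0 // ler_wpM2r ?mulr_ge0 ?subr_ge0 //.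
by rewrite ler_pM2r // mu_le.
Qed.

Lemma lagrangian_growth lam y z : argmin lam y ->
  lagrangian f lam y + mu / 2 * dotm (z - y) (z - y) <= lagrangian f lam z.
Proof.
move=> [_ ymin]; rewrite -subr_le0.
apply: (@le0_of_le_small_mul R _ (mu / 2 * dotm (z - y) (z - y))) => t t0 t1.
have := ymin (t *: z + (1 - t) *: y) (fun _ => I).
have := objective_strongly_convex y z (ltW t0) (ltW t1).
move: (dotm (z - y) (z - y)) => w.
rewrite !lagrangian_adj dotmDr !dotmZr => h1 h2.
rewrite -(ler_pM2l t0); move: h1 h2; lra.
Qed.

Lemma lagrangian_upper lam y v : argmin lam y ->
  lagrangian f lam (y + v) <= lagrangian f lam y + L / 2 * dotm v v.
Proof.
move=> [_ ymin].
pose G w := \sum_i dotm (grad (f i) (row i y)) (row i w) + dotm (diff_adj lam) w.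
have upper w : lagrangian f lam (y + w) <= lagrangian f lam y + G w + L / 2 * dotm w w.
  rewrite !lagrangian_adj dotmDr /G.
  suff : objective f (y + w) <= objective f y
      + \sum_i dotm (grad (f i) (row i y)) (row i w) + L / 2 * dotm w w by lra.
  rewrite dotm_rows /objective !mulr_sumr -!big_split /=.
  apply: ler_sum => i _; rewrite linearD /=.
  apply: le_trans (lipschitz_grad_upper (ltW (Li_gt0 i)) (f_diff i) (f_lip i) _ _) _.
  by rewrite lerD2l ler_wpM2r ?dotm_ge0 // ler_pM2r.
have GZ t w : G (t *: w) = t * G w.
  rewrite /G dotmZr mulrDr; congr (_ + _); rewrite mulr_sumr.
  by apply: eq_bigr => i _; rewrite linearZ /= dotmZr.
(* [G] is the differential of the Lagrangian at its minimizer [y]; steps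
   [- t *: v] show that it is nonpositive. *)
suff : G v <= 0 by have := upper v; lra.
apply: (@le0_of_le_small_mul R _ (L / 2 * dotm v v)) => t t0 _.
have := upper (- t *: v); have := ymin (y + - t *: v) (fun _ => I).
rewrite GZ dotmZl dotmZr => h1 h2.
rewrite -(ler_pM2l t0); move: h1 h2; lra.
Qed.

Lemma lagrangian_shift_ge lam lam' y z : argmin lam y ->
  lagrangian f lam y + dotm (lam' - lam) (diff_op y)
    - (2 + 2 * c) / mu / 2 * dotm (lam' - lam) (lam' - lam)
  <= lagrangian f lam' z.
Proof.
move=> ymin; rewrite (lagrangian_shift lam lam') (diff_adjP m_ge2).
have := lagrangian_growth z ymin.
have /andP[_] := diff_adj_bounds m_ge2 (lam' - lam).
set b := diff_adj _; set d2 := dotm (lam' - lam) _.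
have -> : dotm b z = dotm b (z - y) + dotm b y by rewrite dotmDr dotmNr subrK.
have := dotm_ge0 (mu *: (z - y) + b); move: (z - y) => w.
rewrite dotmDl !(dotmDr _ _ b) !dotmZl !dotmZr (dotmC w b) => h1 h2 h3.
rewrite -(ler_pM2l mu_gt0).
have -> : mu * (lagrangian f lam y + dotm b y - (2 + 2 * c) / mu / 2 * d2)
   = mu * (lagrangian f lam y + dotm b y) - (2 + 2 * c) / 2 * d2.
  by field; rewrite gt_eqF.
move: (ler_wpM2l (ltW mu_gt0) h3) h1 h2; lra.
Qed.

Lemma lagrangian_shift_le lam lam' y : argmin lam y ->
  exists z, lagrangian f lam' z <= lagrangian f lam y
    + dotm (diff_op y) (diff_op y) / (2 * ((2 - 2 * c) / L)).
Proof.
move=> ymin; set b := diff_adj (lam' - lam).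
(* The minimizer of the quadratic upper bound of the shifted Lagrangian. *)
exists (y + - L^-1 *: b).
rewrite (lagrangian_shift lam lam') -/b dotmDr dotmZr.
have := lagrangian_upper (- L^-1 *: b) ymin; rewrite dotmZl dotmZr.
have /andP[+ _] := diff_adj_bounds m_ge2 (lam' - lam).
rewrite -/b -(diff_adjP m_ge2 _ y).
have k0 : 0 < 2 - 2 * c by have := cos_pi_div_lt1 R m_ge2; lra.
set k := 2 - 2 * c in k0 *.
have := dotm_ge0 (k *: (lam' - lam) - L *: diff_op y).
move: (lam' - lam) (diff_op y) => d a.
rewrite dotmDl !dotmDr !dotmNl !dotmNr !dotmZl !dotmZr (dotmC a d).
have L0 : L != 0 by rewrite gt_eqF.
move=> h1 h2 h3.
have kL : 0 < 2 * k / L by rewrite divr_gt0 ?mulr_gt0.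
have E : dotm d a <= (2 * L)^-1 * (k * dotm d d) + dotm a a / (2 * (k / L)).
  have kL2 : 0 < (2 * k * L)^-1 by rewrite invr_gt0 !mulr_gt0.
  rewrite -subr_ge0; apply: le_trans (mulr_ge0 (ltW kL2) h1) _.
  by rewrite le_eqVlt; apply/orP; left; apply/eqP; field; rewrite L0 gt_eqF.
have F : (2 * L)^-1 * (k * dotm d d) <= (2 * L)^-1 * dotm b b.
  by apply: ler_wpM2l h2; rewrite invr_ge0 mulr_ge0 ?ltW.
have G : L / 2 * (- L^-1 * (- L^-1 * dotm b b)) = (2 * L)^-1 * dotm b b.
  by field.
have H : - L^-1 * dotm b b = - (2 * ((2 * L)^-1 * dotm b b)) by field.
rewrite H; rewrite G in h3; move: h3 E F; lra.
Qed.

Lemma strong_convexity_le_lipschitz lam y : (0 < n)%N -> argmin lam y -> mu <= L.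
Proof.
move=> n_gt0 ymin; pose v : 'M[R]_(m, n) := const_mx 1.
have v0 : 0 < dotm v v.
  rewrite lt0r dotm_ge0 andbT dotm_eq0; apply/eqP => /matrixP.
  move=> /(_ (Ordinal (ltnW m_ge2)) (Ordinal n_gt0)); rewrite !mxE.
  by apply/eqP; rewrite oner_eq0.
have := lagrangian_growth (y + v) ymin; rewrite [y + v]addrC addrK [v + y]addrC.
move=> /le_trans /(_ (lagrangian_upper v ymin)).
by rewrite lerD2l ler_pM2r // ler_pM2r.
Qed.

Lemma dual_argmin lam y : argmin lam y ->
  dual setT f lam = (lagrangian f lam y)%:E.
Proof.
move=> [yin ymin]; apply/eqP; rewrite eq_le; apply/andP; split.
  by apply: ereal_inf_lbound; exists y.
by apply: le_ereal_inf_tmp => _ [z zin <-]; rewrite lee_fin; exact: ymin.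
Qed.

End Lagrangian.

Lemma diff_opD (R : realType) (m n : nat) (u v : 'M[R]_(m, n)) :
  diff_op (u + v) = diff_op u + diff_op v.
Proof. by apply/matrixP => i j; rewrite !mxE; ring. Qed.

Lemma diff_op_distortion_le (R : realType) (m n : nat) (eps : 'I_m -> R)
    (r : 'M[R]_(m, n)) :
  (forall i, enorm (row i r) <= eps i) ->
  dotm (diff_op r) (diff_op r) <= total_distortion eps ^+ 2.
Proof.
move=> r_le; rewrite sqr_sqrtr ?sumr_ge0 // => [|i _]; last exact: sqr_ge0.
rewrite dotm_rows; apply: ler_sum => i _.
have -> : row i (diff_op r) = row (pair_fst i) r - row (pair_snd i) r.
  by apply/rowP => j; rewrite !mxE.
rewrite -sqr_enorm lerXn2r ?nnegrE ?enorm_ge0 //.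
  by rewrite addr_ge0 // (le_trans (enorm_ge0 _) (r_le _)).
exact: le_trans (enormB_le _ _) (lerD (r_le _) (r_le _)).
Qed.

Lemma geometric_recursion (R : realType) (a : nat -> R) (q D : R) :
  0 <= q -> 0 <= D -> (forall k, a k.+1 <= q * a k + (1 - q) * D) ->
  forall k, a k <= q ^+ k * a 0%N + D.
Proof.
move=> q0 D0 aS k.
suff : a k <= q ^+ k * (a 0%N - D) + D.
  by have := mulr_ge0 (exprn_ge0 k q0) D0; lra.
elim: k => [|k IH]; first by rewrite expr0; lra.
apply: le_trans (aS k) _; have := ler_wpM2l q0 IH; rewrite exprS; lra.
Qed.

Theorem corollary2 (R : realType) (m n : nat) (m_ge2 : (2 <= m)%N)
    (n_ge1 : (1 <= n)%N)
    (f : 'I_m -> 'rV[R]_n -> R) (mui Li : 'I_m -> R)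
    (f_strict : forall i, strictly_convex (f i))
    (f_closed : forall i, closed_function (f i))
    (mui_gt0 : forall i, 0 < mui i)
    (f_strong : forall i, strongly_convex (mui i) (f i))
    (Li_gt0 : forall i, 0 < Li i)
    (f_diff : forall i x, differentiable (f i) x)
    (f_lip : forall i, lipschitz_grad (Li i) (f i)) :
  let mu := family_min (ltnW m_ge2) mui in
  let L := family_max (ltnW m_ge2) Li in
  let L_h := 1 / mu * (2 + 2 * cos (pi / m%:R)) in
  let mu_h := 1 / L * (2 - 2 * cos (pi / m%:R)) in
  let h := neg_dual [set: 'rV[R]_n] f in
  forall (lambda_opt : 'M[R]_(m.-1, n))
    (opt : dual_optimal [set: 'rV[R]_n] f lambda_opt)
    (gamma : R) (gamma_gt0 : 0 < gamma) (gamma_le : gamma <= 1 / L_h)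
    (eps : 'I_m -> R) (r y : nat -> 'M[R]_(m, n))
    (lambda : nat -> 'M[R]_(m.-1, n))
    (r_le : forall i k, enorm (row i (r k)) <= eps i)
    (alg : inexact_dual_algorithm [set: 'rV[R]_n] f (fun=> gamma) r y lambda),
  let epsilon := total_distortion eps in
  (forall k : nat,
    (h (lambda k) - h lambda_opt <=
      ((1 - gamma * mu_h) ^+ k)%:E * (h (lambda 0%N) - h lambda_opt)
      + (epsilon ^+ 2 / (2 * mu_h))%:E)%E) /\
  (limn_esup (fun k => (h (lambda k) - h lambda_opt)%E) <=
    (epsilon ^+ 2 / (2 * mu_h))%:E)%E.
Proof.
move=> mu L L_h mu_h h lambda_opt opt gamma gamma_gt0 gamma_le eps r y lambda r_le alg epsilon.
have mu_le i : mu <= mui i by exact: bigmin_le.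
have Li_le i : Li i <= L by exact: le_bigmax.
have mu_gt0 : 0 < mu by apply: lt_bigmin => // i _.
have L_gt0 : 0 < L by apply: lt_le_trans (Li_le (Ordinal (ltnW m_ge2))).
have c0 := cos_pi_div_ge0 R m_ge2; have c1 := cos_pi_div_lt1 R m_ge2.
have ymin k := (alg k).1; have lambdaS k := (alg k).2.
have mu_le_L : mu <= L.
  exact: (strong_convexity_le_lipschitz m_ge2 mu_le f_strong Li_gt0 Li_le
            f_diff f_lip n_ge1 (ymin 0%N)).
set c := cos (pi / m%:R : R) in c0 c1 L_h mu_h gamma_le *.
have L_h_gt0 : 0 < L_h by rewrite /L_h mulr_gt0 ?divr_gt0 //; lra.
have mu_h_gt0 : 0 < mu_h by rewrite /mu_h mulr_gt0 ?divr_gt0 //; lra.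
have gammaL : gamma * L_h <= 1 by rewrite -ler_pdivlMr.
have gamma_mu_le1 : gamma * mu_h <= 1.
  apply: le_trans gammaL; rewrite ler_pM2l // /mu_h /L_h ler_pM //; try lra.
  - by rewrite ltW // divr_gt0.
  - by rewrite !div1r lef_pV2.
pose x k := lagrangian f (lambda k) (y k).
have dualE k : dual setT f (lambda k) = (x k)%:E by exact: dual_argmin (ymin k).
have dual_le z : (dual setT f lambda_opt <= (lagrangian f lambda_opt z)%:E)%E.
  by apply: ereal_inf_lbound; exists z.
have [d dE] : exists d, dual setT f lambda_opt = d%:E.
  have := opt (lambda 0%N); have := dual_le 0; rewrite dualE.
  by case: (dual _ _ _) => [d _ _| |] //; exists d.
have hE k : (h (lambda k) - h lambda_opt = (d - x k)%:E)%E.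
  by rewrite /h /neg_dual dualE dE -!EFinN -EFinD opprK addrC.
have step k : d - x k.+1 <= (1 - gamma * mu_h) * (d - x k)
    + (1 - (1 - gamma * mu_h)) * (epsilon ^+ 2 / (2 * mu_h)).
  have := lagrangian_shift_ge m_ge2 mu_gt0 mu_le f_strong (lambda k.+1) (y k.+1) (ymin k).
  have -> : lambda k.+1 - lambda k = gamma *: (diff_op (y k) + diff_op (r k)).
    by rewrite lambdaS addrC addKr diff_opD.
  have := diff_op_distortion_le (fun i => r_le i k).
  have [z] := lagrangian_shift_le m_ge2 L_gt0 Li_gt0 Li_le f_diff f_lip lambda_opt (ymin k).
  have := dual_le z; rewrite dE lee_fin => /le_trans h1 /h1.
  have := dotm_ge0 (diff_op (y k) + diff_op (r k)).
  rewrite -/c -/epsilon -/(x k) -/(x k.+1) !dotmZl dotmZr.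
  have -> : (2 + 2 * c) / mu = L_h by rewrite /L_h mulrC div1r.
  have -> : (2 - 2 * c) / L = mu_h by rewrite /mu_h mulrC div1r.
  have -> : (1 - (1 - gamma * mu_h)) * (epsilon ^+ 2 / (2 * mu_h))
      = gamma / 2 * epsilon ^+ 2 by field; rewrite gt_eqF.
  move: (diff_op (y k)) (diff_op (r k)) => a e.
  move=> ae0 PL e_le descent.
  have h2 : L_h / 2 * (gamma * (gamma * dotm (a + e) (a + e)))
      <= gamma / 2 * dotm (a + e) (a + e).
    have g0 : 0 <= gamma / 2 * dotm (a + e) (a + e).
      by rewrite mulr_ge0 // divr_ge0 // ltW.
    by have := ler_wpM2r g0 gammaL; lra.
  have h3 : gamma * mu_h * (d - x k) <= gamma / 2 * dotm a a.
    have -> : gamma / 2 * dotm a a = gamma * mu_h * (dotm a a / (2 * mu_h)).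
      by field; rewrite gt_eqF.
    by apply: ler_wpM2l; rewrite ?lerBlDl // mulr_ge0 ?ltW.
  have h4 : gamma / 2 * dotm e e <= gamma / 2 * epsilon ^+ 2.
    by apply: ler_wpM2l => //; rewrite divr_ge0 // ltW.
  move: descent h2; rewrite !dotmDl !dotmDr (dotmC e a); move: h3 h4; lra.
have q0 : 0 <= 1 - gamma * mu_h by rewrite subr_ge0.
have D0 : 0 <= epsilon ^+ 2 / (2 * mu_h).
  by rewrite divr_ge0 ?sqr_ge0 // mulr_ge0 // ltW.
have bound := geometric_recursion q0 D0 step.
split=> [k|].
  by rewrite !hE -EFinM -EFinD lee_fin.
apply: (@limn_esup_le_geometric R _ (1 - gamma * mu_h) (d - x 0%N)) => [|k].
  by rewrite ger0_norm // ltrBlDr ltrDl mulr_gt0.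
by rewrite hE lee_fin.
Qed.
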